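(* Let $G$ be a finite smooth domain in the triangular lattice graph $X$ with boundary $C=\delta G$. Then $$\sum_{p\in C}K(p)=12\,\chi(G),\qquad K(p)=2|S_1(p)|-|S_2(p)|,$$ where $\chi(G)$ is the Euler characteristic of $G$.
   Context: $X$ is the infinite triangular lattice graph: its vertices are the points $k(1,0)+l\,(1/2,\sqrt3/2)$ with $k,l\in\mathbb{Z}$, and its edges are the pairs of vertices at Euclidean distance $1$. For a subgraph $G$ of $X$ and a vertex $p$ of $G$, the sphere $S_r(p)$ in $G$ is the graph whose vertices are the vertices of $G$ at geodesic (graph) distance exactly $r$ from $p$ within $G$, and whose edges are all edges of $G$ joining two such vertices. $|S_r(p)|$ denotes the number of edges of $S_r(p)$ (its arc length). Dimension (inductive, for arbitrary graphs): a vertex is $0$-dimensional if it has no neighbours, and a graph is $0$-dimensional if all its vertices are $0$-dimensional (it has no edges). A vertex $p$ is $1$-dimensional if $S_1(p)$ is a nonempty $0$-dimensional graph, and a graph is $1$-dimensional if all its vertices are. A vertex $p$ is $2$-dimensional if $S_1(p)$ is a nonempty $1$-dimensional graph, and a graph is $2$-dimensional if all its vertices are. A vertex $p$ of $G$ is an interior point of $G$ if the sphere $S_1(p)$ in $G$ equals the sphere $S_1(p)$ in $X$ (the full hexagonal $6$-cycle). A vertex $p$ of $G$ is a boundary point of $G$ if it is not an interior point but has a neighbour in $G$ which is an interior point. $\operatorname{int}(G)$ is the set of interior points and $\delta G$ is the set of boundary points. A subgraph $G$ of $X$ (finite or infinite) is a domain if: (i) $G$ is a $2$-dimensional graph; (ii)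 every vertex of $G$ is an interior point or a boundary point; (iii) the set of boundary points, with the edges of $G$ between them, is a $1$-dimensional graph; (iv) if two vertices $p,q$ of $G$ have distance $1$ in $X$, then $(p,q)$ is an edge of $G$ (so $G$ is the induced subgraph on its vertex set); (v) any two distinct interior points of $G$ which have a common neighbouring boundary point either have distance $1$ or are both adjacent to a third interior point of $G$. A domain is finite if it is a finite graph. A domain $G$ is smooth if its complement $G'$, the subgraph of $X$ induced on $X\setminus\operatorname{int}(G)$, is also a domain; then $\delta G=\delta G'$, and $\operatorname{int}(G)$, $\delta G$, $\operatorname{int}(G')$ partition $X$. The Euler characteristic of a finite domain $G$ is $\chi(G)=v-e+f$, where $v$ is the number of vertices of $G$, $e$ the number of edges of $G$ (unordered pairs of vertices at distance $1$), and $f$ the number of faces, a face being a triangle, i.e. a set of three vertices of $G$ with mutual distance $1$. *)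

(* Defs.v *)
From HB Require Import structures.
From mathcomp Require Import all_boot all_order all_algebra finmap.
From mathcomp Require Import boolp classical_sets functions cardinality fsbigop.
From mathcomp Require Import reals.

Set Implicit Arguments.
Unset Strict Implicit.
Unset Printing Implicit Defensive.

Import Order.TTheory GRing.Theory Num.Theory.

Local Open Scope classical_set_scope.
Local Open Scope ring_scope.

Record graph (T : choiceType) := Graph {
  vert : set T;
  edge : rel T;
  edge_vert : forall p q, edge p q -> vert p;
  edge_sym : symmetric edge;
  edge_irr : irreflexive edge }.

Lemma graph_ext (T : choiceType) (G H : graph T) :
  vert G = vert H -> edge G =2 edge H -> G = H.
Proof.
case: G => V e v s i; case: H => V' e' v' s' i' /= eV ee.
have {}ee : e = e' by apply/funext => p; apply/funext => q; exact: ee.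
subst V' e'; congr Graph; exact: Prop_irrelevance.
Qed.

Section Graphs.
Variable T : choiceType.
Implicit Types (X G : graph T) (A : set T) (p q r : T).

Definition subgraph G X : Prop :=
  vert G `<=` vert X /\ (forall p q, edge G p q -> edge X p q).

Definition induced_edge G A : rel T :=
  fun p q => [&& edge G p q, p \in A & q \in A].

Lemma induced_edge_vert G A p q : induced_edge G A p q -> (vert G `&` A) p.
Proof. by case/and3P => /edge_vert Gp; rewrite inE. Qed.

Lemma induced_edge_sym G A : symmetric (induced_edge G A).
Proof. by move=> p q; rewrite /induced_edge edge_sym [(p \in A) && _]andbC. Qed.

Lemma induced_edge_irr G A : irreflexive (induced_edge G A).
Proof. by move=> p; rewrite /induced_edge edge_irr. Qed.

Definition induced G A : graph T :=
  Graph (@induced_edge_vert G A) (@induced_edge_sym G A)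
        (@induced_edge_irr G A).

Definition walk G (n : nat) p q : Prop :=
  vert G p /\
  exists s : seq T, [/\ path (edge G) p s, last p s = q & size s = n].

Definition at_distance G (r : nat) p q : Prop :=
  walk G r p q /\ forall m, (m < r)%N -> ~ walk G m p q.

Definition sphere G (r : nat) p : graph T :=
  induced G [set q | at_distance G r p q].

Fixpoint vertex_dim (n : nat) G p : Prop :=
  if n is m.+1 then
    vert (sphere G 1 p) !=set0 /\
    (forall q, vert (sphere G 1 p) q -> vertex_dim m (sphere G 1 p) q)
  else forall q, ~~ edge G p q.

Definition graph_dim (n : nat) G : Prop :=
  forall p, vert G p -> vertex_dim n G p.

Definition interior X G : set T :=
  [set p | vert G p /\ sphere G 1 p = sphere X 1 p].

Definition boundary X G : set T :=
  [set p | [/\ vert G p, ~ interior X G p &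
               exists2 q, edge G p q & interior X G q]].

Record domain X G : Prop := Domain {
  domain_sub : subgraph G X;
  domain_dim2 : graph_dim 2 G;
  domain_cover : forall p, vert G p -> interior X G p \/ boundary X G p;
  domain_bd_dim1 : graph_dim 1 (induced G (boundary X G));
  domain_full : forall p q, vert G p -> vert G q -> edge X p q -> edge G p q;
  domain_link : forall p q, interior X G p -> interior X G q -> p != q ->
    (exists2 b, boundary X G b & edge G p b /\ edge G q b) ->
    edge X p q \/
    (exists2 r, interior X G r & edge G p r /\ edge G q r) }.

Definition complement X G : graph T := induced X (~` interior X G).

Definition smooth X G : Prop := domain X (complement X G).

(* [fset_set] sends an infinite set to [fset0]: the counts below are meaningful
   only for graphs with finitely many vertices and edges. *)
Definition nb_vert G : nat := #|` fset_set (vert G)|.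

Definition nb_edges G : nat :=
  #|` fset_set [set e : {fset T} |
        exists p q, edge G p q /\ e = [fset p; q]%fset]|.

Definition nb_faces G : nat :=
  #|` fset_set [set f : {fset T} |
        exists p q r, [/\ edge G p q, edge G q r, edge G p r &
                          f = [fset p; q; r]%fset]]|.

Definition euler_char G : int :=
  (nb_vert G)%:Z - (nb_edges G)%:Z + (nb_faces G)%:Z.

Definition curvature G p : int :=
  2 * (nb_edges (sphere G 1 p))%:Z - (nb_edges (sphere G 2 p))%:Z.

End Graphs.

Section TriangularLattice.
Variable R : realType.

(* The norm carried by [R * R] in the library is the sup norm. *)
Definition euclid_dist (x y : R * R) : R :=
  Num.sqrt ((x.1 - y.1) ^+ 2 + (x.2 - y.2) ^+ 2).

(* The vertex k(1,0) + l(1/2, sqrt 3 / 2) is encoded by its pair of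
   coordinates (k, l). *)
Definition lattice_point (p : int * int) : R * R :=
  (p.1%:~R + p.2%:~R / 2, p.2%:~R * (Num.sqrt 3 / 2)).

Definition lattice_edge : rel (int * int) :=
  fun p q => euclid_dist (lattice_point p) (lattice_point q) == 1.

Lemma lattice_edge_vert p q : lattice_edge p q -> [set: int * int] p.
Proof. by []. Qed.

Lemma lattice_edge_sym : symmetric lattice_edge.
Proof.
move=> p q; rewrite /lattice_edge /euclid_dist.
by rewrite -sqrrN opprB -[X in _ + X]sqrrN opprB.
Qed.

Lemma lattice_edge_irr : irreflexive lattice_edge.
Proof.
move=> p; rewrite /lattice_edge /euclid_dist !subrr expr0n /= addr0 sqrtr0.
by rewrite eq_sym oner_eq0.
Qed.

Definition triangular_lattice : graph (int * int)%type :=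
  Graph lattice_edge_vert lattice_edge_sym lattice_edge_irr.

End TriangularLattice.

(* Main.v *)
Require Import Defs.
From mathcomp Require Import all_boot all_order all_algebra finmap.
From mathcomp Require Import boolp classical_sets functions cardinality fsbigop.
From mathcomp Require Import reals zify ring.

Set Implicit Arguments.
Unset Strict Implicit.
Unset Printing Implicit Defensive.

Import Order.TTheory GRing.Theory Num.Theory.

Local Open Scope classical_set_scope.
Local Open Scope ring_scope.

(* Colour a lattice point I (interior to G), B (boundary) or O (the rest).  No I
   is adjacent to an O, so smoothness and the dimension conditions force the six
   neighbours of a boundary point p to be cyclically B I^a B O^(4 - a) with
   1 <= a <= 3; put t(p) = 2 - a.
   Splitting edges and faces evenly among their vertices, interior points
   contribute 1 - 6/2 + 6/3 = 0 to the Euler characteristic and boundary points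
   contribute 1 - (a + 2)/2 + (a + 1)/3 = t(p)/6, so that the t(p) add up to
   6 chi(G).  On the other hand |S_1(p)| = a + 1, and among the edges of S_2(p)
   an interior neighbour of p accounts for 2 and a boundary neighbour q for
   1 - t(q); hence K(p) = t(q) + t(q'), where q and q' are the two boundary
   neighbours of p, and summing over p counts every t(q) twice. *)

(** * Counting edges and faces of a graph *)

Section GraphCounting.
Variable T : choiceType.
Implicit Types (G H : graph T) (p q r : T) (L : seq T).

Lemma edge_vertr G p q : edge G p q -> vert G q.
Proof. by rewrite edge_sym => /edge_vert. Qed.

Lemma at_distance1 G p q : at_distance G 1 p q <-> edge G p q.
Proof.
split=> [[[_ [[|x [|y s]] []]] //=]|e]; first by rewrite andbT => e <-.
split; first by split; [exact: edge_vert e | exists [:: q]; rewrite /= e].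
case=> // _ [_ [[|x s] [_ /= pq //]]].
by move: e; rewrite pq edge_irr.
Qed.

Lemma at_distance2 G p q : at_distance G 2 p q <->
  [/\ p != q, ~~ edge G p q & exists2 r, edge G p r & edge G r q].
Proof.
split=> [[[Gp [[|x [|y [|z s]]] []]] //= + + _ nw]|[npq ne [r pr rq]]].
  case/and3P=> px xy _ yq; subst q; split; last by exists x.
    by apply/eqP => py; apply: (nw 0%N) => //; split=> //; exists [::].
  apply/negP => e; apply: (nw 1%N) => //; split=> //; exists [:: y].
  by rewrite /= e.
split; first by split; [exact: edge_vert pr |
    exists [:: r; q]; rewrite /= pr rq].
case=> [|[|//]] _ [_ [s [ps ls]]].
  by move/size0nil => s0; rewrite -ls s0 eqxx in npq.
by case: s ps ls => [|x [|]] //=; rewrite andbT => + xq; rewrite xq (negbTE ne).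
Qed.

Lemma induced_edgeE G (A : set T) p q :
  edge (induced G A) p q = [&& edge G p q, p \in A & q \in A].
Proof. by []. Qed.

Lemma sphere_edgeE G n p q r :
  edge (sphere G n p) q r =
  [&& edge G q r, `[< at_distance G n p q >] & `[< at_distance G n p r >]].
Proof. by []. Qed.

Lemma sphere1_edgeE G p q r :
  edge (sphere G 1 p) q r = [&& edge G q r, edge G p q & edge G p r].
Proof.
rewrite sphere_edgeE.
by congr [&& _, _ & _]; apply/asboolP/idP => /at_distance1.
Qed.

Lemma sphere1_vertE G p q : vert (sphere G 1 p) q <-> edge G p q.
Proof.
split=> [[_ /at_distance1] //|e].
by split; [exact: edge_vertr e | apply/at_distance1].
Qed.

(** An edge of the link of [p] is a triangle through [p]. Applied to the boundary graph, this
    forbids three pairwise adjacent boundary points. *)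
Lemma vertex_dim1P G p : vertex_dim 1 G p <->
  (exists q, edge G p q) /\
  (forall q r, edge G p q -> edge G p r -> ~~ edge G q r).
Proof.
split=> [[[q /sphere1_vertE pq] dim0]|[[q pq] dim0]].
  split=> [|q' r pq' pr]; first by exists q.
  by have := dim0 q' (iffRL (sphere1_vertE _ _ _) pq') r;
    rewrite sphere1_edgeE pq' pr !andbT.
split=> [|q' /sphere1_vertE pq' r]; first by exists q; apply/sphere1_vertE.
by rewrite sphere1_edgeE pq'; apply/negP => /and3P[e _ pr]; move: e;
  apply/negP/dim0.
Qed.

Lemma vertex_dim2_common G p q :
  vertex_dim 2 G p -> edge G p q -> exists2 r, edge G p r & edge G q r.
Proof.
case=> _ dim1 pq.
have [[r]] :=
  iffLR (vertex_dim1P _ _) (dim1 q (iffRL (sphere1_vertE _ _ _) pq)).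
by rewrite sphere1_edgeE => /and3P[qr _ pr] _; exists r.
Qed.

(** Supplies the finiteness without which [fset_set] would collapse to the empty set. *)
Lemma finite_fsubsets (A : set {fset T}) L :
  (forall e, A e -> {subset e <= L}) -> finite_set A.
Proof.
move=> AL.
apply: (@sub_finite_set _ _ [set` fpowerset [fset x in L]%fset]) => //.
move=> e /AL eL /=; rewrite fpowersetE; apply/fsubsetP => x /eL.
by rewrite !inE.
Qed.

(** Double counting of the pairs formed by a set of the family and one of its points. *)
Lemma count_incidences L (F : {fset {fset T}}) m : uniq L ->
  (forall e, e \in F -> (#|` e| = m)%N /\ {subset e <= L}) ->
  (m * #|` F| = \sum_(p <- L) count (fun e : {fset T} => p \in e) F)%N.
Proof.
move=> uL FL; under eq_bigr do rewrite -sum1_count big_mkcond /=.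
rewrite exchange_big /= -sum1_size big_distrr /=.
rewrite big_seq_cond [RHS]big_seq_cond; apply: eq_bigr => e;
  rewrite andbT muln1.
move=> /FL[<- eL]; rewrite -big_mkcond /= sum1_count -size_filter.
apply/perm_size/uniq_perm; rewrite ?filter_uniq ?fset_uniq // => x.
by rewrite mem_filter; apply/idP/andP => [xe|[]//]; split=> //; exact: eL.
Qed.

Definition edge_set G : {fset {fset T}} :=
  fset_set [set e | exists p q, edge G p q /\ e = [fset p; q]%fset].

Lemma edge_setP G L e : (forall p, vert G p -> p \in L) ->
  reflect (exists p q, edge G p q /\ e = [fset p; q]%fset) (e \in edge_set G).
Proof.
move=> GL; rewrite /edge_set in_fset_set ?inE; first exact: asboolP.
apply: (finite_fsubsets (L := L)) => _ [p [q [pq ->]]] x; rewrite !inE.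
by move=> /orP[] /eqP ->; apply: GL; [exact: edge_vert pq|exact: edge_vertr pq].
Qed.

(** Handshake lemma: the map from [q] to [{p, q}] matches the neighbours of [p] with the edges
    through [p]. *)
Lemma nb_edges_degree G L : uniq L -> (forall p, vert G p -> p \in L) ->
  (2 * nb_edges G = \sum_(p <- L) count (edge G p) L)%N.
Proof.
move=> uL GL; rewrite (@count_incidences L (edge_set G)) //; last first.
  move=> _ /(edge_setP _ GL)[p [q [pq ->]]]; split.
    by rewrite cardfs2; case: eqP pq => [->|//]; rewrite edge_irr.
  move=> x; rewrite !inE.
  by move=> /orP[] /eqP ->; apply: GL;
    [exact: edge_vert pq|exact: edge_vertr pq].
apply: eq_bigr => p _; rewrite -!size_filter.
rewrite -[RHS](size_map (fun q => [fset p; q]%fset)).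
apply/perm_size/uniq_perm; first by rewrite filter_uniq ?fset_uniq.
  rewrite map_inj_in_uniq ?filter_uniq // => q r.
  rewrite !mem_filter => /andP[pq _] /andP[pr _] /fsetP/(_ q).
  rewrite !inE eqxx orbT => /esym/orP[]/eqP // qp.
  by rewrite qp edge_irr in pq.
move=> e; rewrite mem_filter; apply/andP/mapP => [[+ /(edge_setP _ GL)]|].
  move=> + [q [r [qr ee]]]; rewrite {}ee !inE => /orP[]/eqP ->.
    by exists r => //; rewrite mem_filter qr GL //; exact: edge_vertr qr.
  by exists q; rewrite ?mem_filter 1?edge_sym ?qr ?GL 1?fsetUC //;
    exact: edge_vert qr.
move=> [q]; rewrite mem_filter => /andP[pq _] ->; split;
  first by rewrite !inE eqxx.
by apply/(edge_setP _ GL); exists p, q.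
Qed.

(** A triangle through [p] is [p] joined to an edge of its link, and every triangle has three
    corners. *)
Lemma nb_faces_link G L : uniq L -> (forall p, vert G p -> p \in L) ->
  (3 * nb_faces G = \sum_(p <- L) nb_edges (sphere G 1 p))%N.
Proof.
move=> uL GL.
set F := [set f : {fset T} | exists p q r,
  [/\ edge G p q, edge G q r, edge G p r &
                          f = [fset p; q; r]%fset]].
have FL f : F f -> (#|` f| = 3)%N /\ {subset f <= L}.
  move=> [p [q [r [pq qr pr ->]]]]; split.
    rewrite fsetUC cardfsU1 cardfs2 !inE.
    have/negbTE-> : r != p by apply: contraTneq pr => ->; rewrite edge_irr.
    have/negbTE-> : r != q by apply: contraTneq qr => ->; rewrite edge_irr.
    by have -> : p != q by apply: contraTneq pq => ->; rewrite edge_irr.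
  move=> x; rewrite !inE -orbA => /or3P[] /eqP ->; apply: GL.
  - exact: edge_vert pq.
  - exact: edge_vertr pq.
  - exact: edge_vertr pr.
have memF f : (f \in fset_set F) = `[< F f >].
  rewrite in_fset_set ?inE //.
  by apply: (finite_fsubsets (L := L)) => e /FL[].
rewrite (@count_incidences L (fset_set F)) //; last first.
  by move=> f; rewrite memF => /asboolP /FL.
apply: eq_bigr => p _.
have SL q : vert (sphere G 1 p) q -> q \in L by move=> [Gq _]; exact: GL.
rewrite -[RHS](size_map (fun e => p |` e)%fset (edge_set (sphere G 1 p))).
rewrite -size_filter; apply/perm_size/uniq_perm;
  first by rewrite filter_uniq ?fset_uniq.
  rewrite map_inj_in_uniq ?fset_uniq //.
  (* Edges of the link avoid [p], so adjoining [p] to them is injective. *)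
  have pN e : e \in edge_set (sphere G 1 p) -> p \notin e.
    move=> /(edge_setP _ SL)[q [r []]]; rewrite sphere1_edgeE =>
      /and3P[_ pq pr] ->.
    rewrite !inE; apply/norP; split; [move: pq|move: pr];
      by apply: contraTneq => ->; rewrite edge_irr.
  by move=> e f /pN pe /pN pf ef; rewrite -(fsetU1K pe) ef fsetU1K.
move=> f; rewrite mem_filter memF; apply/andP/mapP.
  move=> [pf /asboolP [a [b [c [ab bc ac ef]]]]].
  have [x [y [px py xy fE]]] : exists x y,
      [/\ edge G p x, edge G p y, edge G x y & f = p |` [fset x; y]]%fset.
    move: pf; rewrite ef !inE -orbA => /or3P[]/eqP ->.
    - by exists b, c; rewrite fsetUA.
    - by exists a, c; rewrite edge_sym ab bc ac fsetUA
          [([fset b; a])%fset]fsetUC.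
    - by exists a, b; rewrite edge_sym ac edge_sym bc ab fsetUC.
  exists [fset x; y]%fset => //; apply/(edge_setP _ SL); exists x, y.
  by rewrite sphere1_edgeE px py xy.
move=> [e /(edge_setP _ SL)[q [r []]]]; rewrite sphere1_edgeE =>
  /and3P[qr pq pr] -> ->.
split; first by rewrite !inE eqxx.
by apply/asboolP; exists p, q, r; rewrite fsetUA.
Qed.

End GraphCounting.

(** * The ring of neighbours *)

Definition dirs : seq (int * int) :=
  [:: (1, 0); (0, 1); (-1, 1); (-1, 0); (0, -1); (1, -1)].

(** The list [dirs] runs counterclockwise and indices are read modulo 6, so [k + 5] is the
    predecessor of [k] and [k + 3] its opposite. *)
Definition dir (k : nat) : int * int := nth 0 dirs (k %% 6).

(** In lattice coordinates the squared distance is the form a^2 + ab + b^2, which takes the value 1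
    at exactly six integer points. *)
Lemma lattice_edgeE (R : realType) (p q : int * int) :
  lattice_edge R p q = (q - p \in dirs).
Proof.
rewrite /lattice_edge /euclid_dist /lattice_point /=.
set s := _ + _.
have sqrt3 : Num.sqrt 3 ^+ 2 = 3 :> R by rewrite sqr_sqrtr.
set a : int := (q - p).1; set b : int := (q - p).2.
have -> : s = (a ^+ 2 + a * b + b ^+ 2)%:~R.
  rewrite !rmorphD !rmorphXn /= rmorphM /a /b /= !rmorphB /s.
  set t : R := Num.sqrt 3.
  rewrite -mulrBl exprMn [(t / 2) ^+ 2]exprMn sqrt3.
  by field.
have n0 : 0 <= a ^+ 2 + a * b + b ^+ 2 by nia.
rewrite -[X in _ == X]sqrtr1 eqr_sqrt ?ler0z ?ler01 // (_ : 1 = 1%:~R) //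
  eqr_int.
rewrite (surjective_pairing (q - p)) -/a -/b.
apply/eqP/idP => [H|]; last first.
  by rewrite !inE !xpair_eqE -!(rwP orP) -!(rwP andP); lia.
(* Four times the form is (2a + b)^2 + 3b^2, and symmetrically in a; the value 1 thus leaves nine
   candidates. *)
have : (-1 <= a <= 1) && (-1 <= b <= 1) by nia.
by rewrite !inE !xpair_eqE => K; nia.
Qed.

Lemma dir_mod k : dir (k + 6) = dir k.
Proof. by rewrite /dir modnDr. Qed.

(** * Cyclic patterns on six places *)

Section RingPattern.
Local Open Scope nat_scope.

Lemma periodic6 (T : Type) (P : nat -> T) :
  (forall k, P (k + 6) = P k) -> forall k, P k = P (k %% 6).
Proof.
move=> P6 k; rewrite {1}(divn_eq k 6) addnC.
by elim: (k %/ 6) => [|n IH]; rewrite ?mul0n ?addn0 // mulSn addnCA addnC P6.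
Qed.

Lemma sum6E (P : pred nat) : \sum_(k < 6) P k = count P (iota 0 6).
Proof.
by rewrite -(big_mkord xpredT (fun k =>
  nat_of_bool (P k))) -sum1_count [RHS]big_mkcond.
Qed.

Fixpoint bitseqs (n : nat) : seq bitseq :=
  if n is m.+1 then
    [seq true :: s | s <- bitseqs m] ++ [seq false :: s | s <- bitseqs m]
  else [:: [::]].

Lemma mem_bitseqs (s : bitseq) : s \in bitseqs (size s).
Proof.
by elim: s => //= -[] s IH; rewrite mem_cat map_f ?orbT.
Qed.

(* Around a boundary point, [v k] and [i k] tell whether the [k]-th neighbour is
   a vertex, respectively an interior point, of the domain. *)
Definition ring_hyp (v i : nat -> bool) :=
  [&& all (fun k => i k ==> [&& v k, v (k + 1) & v (k + 5)]) (iota 0 6),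
      has i (iota 0 6), ~~ all v (iota 0 6),
      all (fun k => v k ==> v (k + 1) ==> i k || i (k + 1)) (iota 0 6),
      all (fun k => v k ==> v (k + 1) || v (k + 5)) (iota 0 6) &
      all (fun k => ~~ i k ==> ~~ i (k + 1) || ~~ i (k + 5)) (iota 0 6)].

(** With a interior places, the last clause looks away from a boundary place [k + 3]: in B I^a B
    O^(4 - a), the opposite place [k] carries a - 1 ring edges. *)
Definition ring_conclusion (v i : nat -> bool) :=
  [&& count (fun k => v k && ~~ i k) (iota 0 6) == 2,
      count v (iota 0 6) == count i (iota 0 6) + 2,
      count (fun k => v k && v (k + 1)) (iota 0 6)
        == count i (iota 0 6) + 1 &
      all (fun k => v (k + 3) && ~~ i (k + 3) ==>
         (count i (iota 0 6) == v k * (v (k + 1) + v (k + 5)) + 1)) (iota 0 6)].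

(** Periodic functions are tables of six bits, so the implication is decided by computation on all
    2^12 pairs of tables. *)
Lemma ring_check (v i : nat -> bool) :
  (forall k, v (k + 6) = v k) -> (forall k, i (k + 6) = i k) ->
  ring_hyp v i ==> ring_conclusion v i.
Proof.
pose per (s : bitseq) k := nth false s (k %% 6).
have perE (P : nat -> bool) : (forall k, P (k + 6) = P k) ->
    P = per (mkseq P 6).
  move=> P6; apply/funext => k; rewrite /per nth_mkseq ?ltn_pmod //.
  exact: periodic6.
move=> /perE -> /perE ->.
move: (mem_bitseqs (mkseq v 6)) (mem_bitseqs (mkseq i 6)); rewrite !size_mkseq.
move: (mkseq v 6) (mkseq i 6) => s t ss tt.
suff /allP /(_ s ss) /allP /(_ t tt) :
  all (fun s => all (fun t => ring_hyp (per s) (per t) ==>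
     ring_conclusion (per s) (per t)) (bitseqs 6)) (bitseqs 6) by [].
by vm_compute.
Qed.

(** The hypotheses give every B an I on one side and an O on the other. The ring is then made of
    blocks B I^a B O^c with a, c >= 1; each has length at least 4, so six places hold only one. *)
Lemma ring_pattern (v i : nat -> bool) :
  (forall k, v (k + 6) = v k) -> (forall k, i (k + 6) = i k) ->
  (forall k, i k -> [&& v k, v (k + 1) & v (k + 5)]) ->
  (exists2 k, k < 6 & i k) -> (exists2 k, k < 6 & ~~ v k) ->
  (forall k, v k -> v (k + 1) -> i k || i (k + 1)) ->
  (forall k, v k -> v (k + 1) || v (k + 5)) ->
  (forall k, ~~ i k -> ~~ i (k + 1) || ~~ i (k + 5)) ->
  [/\ \sum_(k < 6) (v k && ~~ i k) = 2,
      \sum_(k < 6) v k = \sum_(k < 6) i k + 2,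
      \sum_(k < 6) (v k && v (k + 1)) = \sum_(k < 6) i k + 1 &
      forall k, k < 6 -> v (k + 3) -> ~~ i (k + 3) ->
        \sum_(k < 6) i k = v k * (v (k + 1) + v (k + 5)) + 1].
Proof.
move=> v6 i6 iv [k1 k1lt e1] [k2 k2lt e2] bb vv ii.
have /implyP/(_ _)/and4P[] := ring_check v6 i6.
  apply/and5P; split; last (apply/andP; split);
    try by (apply/allP => k _; apply/implyP; auto).
  - by apply/hasP; exists k1; rewrite ?mem_iota.
  - by apply/allPn; exists k2; rewrite ?mem_iota.
  - by apply/allP => k _; apply/implyP => vk; apply/implyP; exact: bb.
move=> /eqP e3 /eqP e4 /eqP e5 /allP e6.
rewrite (sum6E (fun k => v k && ~~ i k)) (sum6E v) (sum6E i).
rewrite (sum6E (fun k => v k && v (k + 1))); split=> // k klt vk ik.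
by apply/eqP; move: (e6 k); rewrite mem_iota vk ik => /(_ klt).
Qed.

End RingPattern.

Lemma dir_modDl k m : dir (k %% 6 + m) = dir (k + m).
Proof. by rewrite /dir modnDml. Qed.

Lemma dir_modE k : dir k = dir (k %% 6).
Proof. by rewrite /dir modn_mod. Qed.

Lemma dir_mem k : dir k \in dirs.
Proof. by apply: mem_nth; rewrite ltn_mod. Qed.

Lemma dirs_dirP d : d \in dirs -> exists2 k, (k < 6)%N & d = dir k.
Proof.
move=> dd; exists (index d dirs); first by rewrite index_mem.
by rewrite /dir modn_small ?nth_index // index_mem.
Qed.

Lemma forall_dir (P : nat -> Prop) : (forall k, P (k %% 6)%N -> P k) ->
  P 0%N -> P 1%N -> P 2%N -> P 3%N -> P 4%N -> P 5%N -> forall k, P k.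
Proof.
move=> Pm P0 P1 P2 P3 P4 P5 k; apply: Pm.
by case: (k %% 6)%N (ltn_pmod k (isT : 0 < 6)%N); do 6?case=> //.
Qed.

(** With [dirD4] and [dirD3]: from [p + dir k], the directions [k + 2] and [k + 4] lead to the
    adjacent places of the ring around [p], and [k + 3] leads back to [p]. *)
Lemma dirD2 k : dir k + dir (k + 2) = dir (k + 1).
Proof.
by elim/forall_dir: k => // k; rewrite !dir_modDl -dir_modE.
Qed.

Lemma dirD4 k : dir k + dir (k + 4) = dir (k + 5).
Proof.
by elim/forall_dir: k => // k; rewrite !dir_modDl -dir_modE.
Qed.

Lemma dirD3 k : dir k + dir (k + 3) = 0.
Proof.
by elim/forall_dir: k => // k; rewrite !dir_modDl -dir_modE.
Qed.

Lemma dir_adj j k : dir j - dir k \in dirs ->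
  dir j = dir (k + 1) \/ dir j = dir (k + 5).
Proof.
elim/forall_dir: k => [k||||||]; first by rewrite !dir_modDl -dir_modE.
all: by elim/forall_dir: j => [j||||||]; rewrite -?dir_modE //; auto.
Qed.

(** * Counting edges by coordinate offsets *)

Definition offset_pairs (O : seq (int * int)) :
    seq ((int * int) * (int * int)) :=
  [seq x <- [seq (c, c') | c <- O, c' <- O] | x.2 - x.1 \in dirs].

(** [offset_pairs O] contains each adjacent pair in both orders and [Q] in one, so the degree sum is
    twice the sum over [Q]; [s] selects the offsets present in the graph. *)
Lemma nb_edges_offsets (H : graph (int * int)%type) (p : int * int)
    (O : seq (int * int)) (s : pred (int * int)) Q :
  uniq O -> (forall q, vert H q -> q - p \in O) ->
  {in O &, forall c c',
    edge H (p + c) (p + c') = [&& c' - c \in dirs, s c & s c']} ->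
  perm_eq (offset_pairs O) (Q ++ [seq (x.2, x.1) | x <- Q]) ->
  nb_edges H = (\sum_(x <- Q) (s x.1 && s x.2))%N.
Proof.
move=> uO HO He OQ; apply/eqP; rewrite -(eqn_pmul2l (isT : 0 < 2)%N); apply/eqP.
have uL : uniq [seq p + c | c <- O] by rewrite map_inj_uniq //; exact: addrI.
rewrite (nb_edges_degree uL); last first.
  by move=> q /HO qO; apply/mapP; exists (q - p) => //; rewrite addrC subrK.
rewrite big_map.
transitivity (\sum_(x <- offset_pairs O) (s x.1 && s x.2))%N.
  rewrite big_filter [RHS]big_mkcond big_allpairs_dep /=.
  rewrite big_seq_cond [RHS]big_seq_cond; apply: eq_bigr => c /andP[cO _].
  rewrite count_map -sum1_count !big_mkcond /= big_seq_cond [RHS]big_seq_cond.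
  apply: eq_bigr => c' /andP[c'O _]; rewrite He //.
  by case: (c' - c \in dirs); case: (s c && s c').
rewrite (perm_big _ OQ) /= big_cat big_map /= mul2n -addnn; congr addn.
by apply: eq_bigr => x _; rewrite andbC.
Qed.

(** * Domains and the ring around a boundary point *)

Section Lattice.
Variable R : realType.
Let X := triangular_lattice R.
Implicit Types (p q r : int * int) (H : graph (int * int)%type).

Lemma lattice_offset p c c' : edge X (p + c) (p + c') = (c' - c \in dirs).
Proof. by rewrite /= lattice_edgeE opprD addrACA subrr add0r. Qed.

Lemma lattice_offset0 p c : edge X p (p + c) = (c \in dirs).
Proof. by rewrite -{1}[p]addr0 lattice_offset subr0. Qed.

Lemma lattice_dir p k : edge X p (p + dir k).
Proof. by rewrite lattice_offset0 dir_mem. Qed.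

Lemma lattice_dirP p q : edge X p q -> exists2 k, (k < 6)%N & q = p + dir k.
Proof.
by rewrite /= lattice_edgeE => /dirs_dirP[k klt e]; exists k;
  rewrite -?e // addrC subrK.
Qed.

Definition full H :=
  forall p q, edge H p q = [&& edge X p q, p \in vert H & q \in vert H].

Lemma domain_fullP H : domain X H -> full H.
Proof.
move=> dH p q; apply/idP/and3P => [e|[e]].
  by split; [exact: (domain_sub dH).2|rewrite inE; exact: edge_vert e|
    rewrite inE; exact: edge_vertr e].
by rewrite !inE => Hp Hq; exact: (domain_full dH).
Qed.

(** Equality of the two spheres as graphs reduces to the presence of the six neighbours, because
    fullness then forces the edges. *)
Lemma interiorP H p : full H ->
  interior X H p <-> vert H p /\ forall k, p + dir k \in vert H.
Proof.
move=> fH; split=> [[Hp S]|[Hp nb]]; split=> //.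
  move=> k; have : edge H p (p + dir k).
    by apply/sphere1_vertE; rewrite S; apply/sphere1_vertE/lattice_dir.
  by rewrite fH => /and3P[].
have E q : edge H p q = edge X p q.
  rewrite fH mem_set //=; apply/idP/idP => [/andP[]//|e]; rewrite e.
  by have [k _ ->] := lattice_dirP e; rewrite nb.
apply: graph_ext.
  apply/seteqP; split=> q /sphere1_vertE e; apply/sphere1_vertE.
    by rewrite -E.
  by rewrite E.
move=> q r; rewrite !sphere1_edgeE !E fH.
case qr: (edge X q r); case pq: (edge X p q); case pr: (edge X p r) => //=;
  rewrite ?andbF //.
have [k _ ->] := lattice_dirP pq; have [j _ ->] := lattice_dirP pr.
by rewrite !nb.
Qed.

(** Two-dimensionality puts the edge from [p] to [p + dir k] in a triangle, whose third corner is
    adjacent to [p + dir k] on the ring. *)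
Lemma dim2_dir H p k : full H -> vertex_dim 2 H p ->
  p \in vert H -> p + dir k \in vert H ->
  (p + dir (k + 1) \in vert H) || (p + dir (k + 5) \in vert H).
Proof.
move=> fH dim2 Hp Hk.
have pk : edge H p (p + dir k) by rewrite fH lattice_dir Hp.
have [r pr kr] := vertex_dim2_common dim2 pk.
have := pr; rewrite fH => /and3P[/lattice_dirP[j _ rE] _ Hr].
have := kr; rewrite fH => /and3P[+ _ _].
rewrite {1}rE lattice_offset => /dir_adj[] <-; rewrite -rE Hr ?orbT //.
Qed.

Section Domain.
Variable G : graph (int * int)%type.
Hypotheses (dG : domain X G) (sG : smooth X G).

Let V p := p \in vert G.
Let I p := p \in interior X G.
Let fG : full G := domain_fullP dG.
Let B := boundary X G.

Lemma edge_dir p k : edge G p (p + dir k) = V p && V (p + dir k).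
Proof. by rewrite fG lattice_dir. Qed.

Lemma mem_interior p : I p = V p && [forall k : 'I_6, V (p + dir k)].
Proof.
rewrite /I /V; apply/idP/andP; rewrite !inE.
  by move=> /(interiorP _ fG)[Vp nb]; split=> //; apply/forallP => k; exact: nb.
move=> [Vp /forallP nb]; apply/(interiorP _ fG); split=> // k.
by have := nb (Ordinal (ltn_pmod k (isT : 0 < 6)%N)); rewrite /= -dir_modE.
Qed.

Lemma interior_vert p : I p -> V p.
Proof. by rewrite mem_interior => /andP[]. Qed.

Lemma interior_dir p k : I p -> V (p + dir k).
Proof. by rewrite /I inE => /(interiorP _ fG)[_ /(_ k)]. Qed.

(** The interior neighbour demanded of a boundary point comes from [domain_cover]. *)
Lemma boundaryE p : (p \in B) = V p && ~~ I p.
Proof.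
rewrite /B /V /I; apply/idP/andP; rewrite !inE; first by case=> Vp nI _;
  rewrite notin_setE.
by rewrite notin_setE => -[Vp nI]; case: (domain_cover dG Vp).
Qed.

Lemma boundary_interior p : p \in B -> exists2 k, (k < 6)%N & I (p + dir k).
Proof.
rewrite inE => -[_ _ [q pq Iq]].
have [k klt qE] := lattice_dirP ((domain_sub dG).2 _ _ pq).
by exists k => //; rewrite -qE inE.
Qed.

Lemma complement_full : full (complement X G).
Proof. exact: domain_fullP sG. Qed.

Lemma complement_vert p : (p \in vert (complement X G)) = ~~ I p.
Proof.
rewrite /I; apply/idP/idP; rewrite inE ?notin_setE; first by case.
by split.
Qed.

(* A boundary point has an interior neighbour, so it cannot be interior in the
   complement; smoothness then gives it a neighbour interior to the complement,
   which is outside the domain. *)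
Lemma boundary_exterior p : p \in B -> exists2 k, (k < 6)%N & ~~ V (p + dir k).
Proof.
move=> Bp; have [j _ Ij] := boundary_interior Bp.
have : p \in vert (complement X G).
  by rewrite complement_vert; move: Bp; rewrite boundaryE => /andP[].
rewrite inE => /(domain_cover sG)[].
  move=> /(interiorP _ complement_full)[_ /(_ j)].
  by rewrite complement_vert Ij.
move=> [_ _ [q pq Iq]]; have := pq; rewrite complement_full => /and3P[eX _ nIq].
have [k klt qE] := lattice_dirP eX; exists k => //; rewrite -qE.
apply/negP => Vq; have /boundary_interior[l _] : q \in B.
  by rewrite boundaryE Vq -complement_vert.
have [_ /(_ l)] := iffLR (interiorP _ complement_full) Iq.
by rewrite complement_vert => /negP.
Qed.

Lemma addr_dir p k m n : dir k + dir m = dir n -> p + dir k + dir m = p + dir n.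
Proof. by rewrite -addrA => ->. Qed.

(** At a boundary point this is the exponent a of the pattern, so t(p) is [2 - nb_int p]. *)
Definition nb_int p := (\sum_(k < 6) I (p + dir k)%R)%N.

Lemma boundary_ring p : p \in B ->
  [/\ \sum_(k < 6) (p + dir k \in B)%R = 2,
      \sum_(k < 6) V (p + dir k)%R = nb_int p + 2,
      \sum_(k < 6) (V (p + dir k)%R && V (p + dir (k + 1))%R) = nb_int p + 1 &
      forall k, k < 6 -> (p + dir (k + 3) \in B)%R ->
        nb_int p = V (p + dir k)%R *
          (V (p + dir (k + 1))%R + V (p + dir (k + 5))%R) + 1]%N.
Proof.
move=> Bp; have := Bp; rewrite boundaryE => /andP[Vp nIp].
case: (@ring_pattern (fun k => V (p + dir k)) (fun k => I (p + dir k))).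
- by move=> k; rewrite dir_mod.
- by move=> k; rewrite dir_mod.
- move=> k Ik; rewrite interior_vert //=.
  rewrite -(addr_dir p (dirD2 k)) -(addr_dir p (dirD4 k)).
  by rewrite !interior_dir.
- exact: boundary_interior.
- exact: boundary_exterior.
(* Two consecutive boundary neighbours would form a triangle with [p] in the boundary graph, which
   is 1-dimensional. *)
- move=> k Vk Vk1; apply/negPn/negP; rewrite negb_or => /andP[nk nk1].
  pose H := induced G B.
  have HE j : V (p + dir j) -> ~~ I (p + dir j) -> edge H p (p + dir j).
    move=> Vj nj; rewrite induced_edgeE edge_dir Vp Vj Bp boundaryE Vj nj.
    by [].
  have : vert H p by split; [move: Vp; rewrite /V inE|move: Bp; rewrite inE].
  move=> /(domain_bd_dim1 dG)/vertex_dim1P[_].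
  move=> /(_ _ _ (HE _ Vk nk) (HE _ Vk1 nk1)).
  rewrite induced_edgeE -(addr_dir p (dirD2 k)) edge_dir Vk.
  by rewrite (addr_dir p (dirD2 k)) Vk1 !boundaryE Vk Vk1 nk nk1.
- move=> k; apply: dim2_dir => //; apply: (domain_dim2 dG).
  by move: Vp; rewrite /V inE.
(* The triangle argument again, now in the complement, whose vertices are the points not interior to
   [G]. *)
- move=> k; rewrite -!complement_vert; apply: dim2_dir => //.
  + exact: complement_full.
  + by apply: (domain_dim2 sG); move: nIp; rewrite -complement_vert inE.
  + by rewrite complement_vert.
move=> e1 e2 e3 e4; split=> //.
  by rewrite -[RHS]e1; apply: eq_bigr => k _; rewrite boundaryE.
by move=> k klt; rewrite boundaryE => /andP[]; exact: e4.
Qed.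

(** * Edges of the spheres of radius one and two *)

Lemma nb_edges_sphere1 p : V p ->
  nb_edges (sphere G 1 p) =
    (\sum_(k < 6) (V (p + dir k)%R && V (p + dir (k + 1))%R))%N.
Proof.
move=> Vp.
rewrite (@nb_edges_offsets _ p dirs (fun c => V (p + c))
  [seq (dir k, dir (k + 1)) | k <- iota 0 6]) //.
- by rewrite big_map -[RHS](big_mkord xpredT (fun k =>
  nat_of_bool (V (p + dir k)%R && V (p + dir (k + 1))%R))).
- by move=> q /sphere1_vertE; rewrite fG /= lattice_edgeE => /andP[].
- move=> c c' /dirs_dirP[k _ ->] /dirs_dirP[j _ ->].
  rewrite sphere1_edgeE !edge_dir Vp fG lattice_offset.
  rewrite -!/(V _); case: (V _); case: (V _); rewrite ?andbF ?andbT //.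
Qed.

(** The lattice hexagon of radius 2 has corners [dir2 k] and side midpoints [mid k]; together they
    form the 12-cycle [ring2]. *)
Definition dir2 k := dir k + dir k.
Definition mid k := dir k + dir (k + 1).
Definition ring2 := flatten [seq [:: dir2 k; mid k] | k <- iota 0 6].

(** Distance is measured inside [G], so an offset of [ring2] counts only if some intermediate
    neighbour of [p] also lies in [G]. *)
Definition in_sphere2 p c :=
  V (p + c) && has (fun d => V (p + d)) [seq d <- dirs | c - d \in dirs].

Lemma ring2_disjoint c : c \in ring2 -> (c != 0) && (c \notin dirs).
Proof. by move: c; apply/allP; vm_compute. Qed.

Lemma ring2_cover j k :
  [|| dir j + dir k == 0, dir j + dir k \in dirs | dir j + dir k \in ring2].
Proof.
elim/forall_dir: k => [k||||||]; first by rewrite -dir_modE.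
all: by elim/forall_dir: j => [j||||||]; rewrite -?dir_modE.
Qed.

Lemma in_sphere2_dir2 p k :
  in_sphere2 p (dir2 k) = V (p + dir2 k) && V (p + dir k).
Proof.
rewrite /in_sphere2;
have -> : [seq d <- dirs | dir2 k - d \in dirs] = [:: dir k].
  by rewrite /dir2; elim/forall_dir: k => // k; rewrite -dir_modE.
by rewrite /= orbF.
Qed.

Lemma in_sphere2_mid p k :
  in_sphere2 p (mid k) =
    V (p + mid k) && (V (p + dir k) || V (p + dir (k + 1))).
Proof.
rewrite /in_sphere2.
have /perm_mem/eq_has_r -> :
    perm_eq [seq d <- dirs | mid k - d \in dirs] [:: dir k; dir (k + 1)].
  by rewrite /mid; elim/forall_dir: k => // k; rewrite dir_modDl -dir_modE.
by rewrite /= orbF.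
Qed.

Lemma in_sphere2P p c : V p -> c \in ring2 ->
  `[< at_distance G 2 p (p + c) >] = in_sphere2 p c.
Proof.
move=> Vp /ring2_disjoint/andP[c0 cd]; apply/asboolP/andP.
  move=> /at_distance2[_ _ [r + rc]].
  rewrite fG => /and3P[/lattice_dirP[k _ rE] _ Vr].
  move: rc; rewrite fG rE lattice_offset => /and3P[cd' _ Vc]; split=> //.
  by apply/hasP; exists (dir k); rewrite ?mem_filter ?cd' ?dir_mem // -rE.
move=> [Vc /hasP[d]]; rewrite mem_filter => /andP[cd' /dirs_dirP[k _ dE]] Vd.
apply/at_distance2; split.
- by rewrite -subr_eq0 opprD addNKr oppr_eq0.
- by rewrite fG lattice_offset0 (negbTE cd).
- exists (p + d); first by rewrite dE edge_dir Vp -dE.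
  by rewrite fG lattice_offset cd'; apply/and3P; split.
Qed.

(** Each edge of the 12-cycle has exactly one corner, and edges are grouped by it. The corner needs
    [p + dir k] in [G], and that point then also serves both adjacent midpoints. *)
Lemma nb_edges_sphere2 p : V p ->
  nb_edges (sphere G 2 p) = (\sum_(k < 6) V (p + dir k)%R *
    (V (p + dir k + dir k)%R * (V (p + dir k + dir (k + 1))%R +
       V (p + dir k + dir (k + 5))%R)))%N.
Proof.
move=> Vp.
rewrite (@nb_edges_offsets _ p ring2 (in_sphere2 p)
  ([seq (dir2 k, mid k) | k <- iota 0 6] ++
   [seq (dir2 k, mid (k + 5)) | k <- iota 0 6])) //; last first.
- move=> c c' cr cr'; rewrite sphere_edgeE fG lattice_offset !in_sphere2P //.
  rewrite /in_sphere2 -!/(V _); case: (V _); case: (V _);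
    rewrite ?andbF ?andbT //.
- move=> q [_ /at_distance2[pq npq [r]]].
  rewrite fG => /and3P[/lattice_dirP[j _ rE] _ _].
  rewrite fG => /and3P[/lattice_dirP[k _ qE] _ Vq].
  have dE : q - p = dir j + dir k by apply/eqP; rewrite subr_eq qE rE -addrA;
    apply/eqP; exact: addrC.
  have := ring2_cover j k; rewrite -dE subr_eq0 eq_sym (negbTE pq) /=.
  by case/orP => // qp; move: npq; rewrite fG /= lattice_edgeE qp -/(V p) Vp Vq.
rewrite big_cat !big_map; etransitivity; first by symmetry; exact: big_split.
rewrite -[RHS](big_mkord xpredT (fun k => (V (p + dir k)%R *
    (V (p + dir k + dir k)%R * (V (p + dir k + dir (k + 1))%R +
       V (p + dir k + dir (k + 5))%R)))%N)).
apply: eq_bigr => k _; rewrite !in_sphere2_dir2 !in_sphere2_mid /mid /dir2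
  !addrA.
rewrite -[(k + 5 + 1)%N]addnA dir_mod -[p + dir (k + 5) + dir k]addrA.
rewrite [dir (k + 5) + _]addrC addrA.
case: (V (p + dir k)); rewrite ?andbF // orbT !andbT mul1n.
by case: (V _); case: (V _); case: (V _).
Qed.

Lemma boundary_curvature p : p \in B ->
  curvature G p = \sum_(k < 6 | p + dir k \in B) (2 - (nb_int (p + dir k))%:Z).
Proof.
move=> Bp; have := Bp; rewrite boundaryE => /andP[Vp nIp].
have [e1 _ e3 _] := boundary_ring Bp.
rewrite /curvature nb_edges_sphere1 // e3.
(* An interior neighbour contributes 2 edges and a boundary neighbour [q] contributes
   [nb_int q - 1]; the added 2, one for each boundary neighbour, avoids truncated subtraction. *)
have : (nb_edges (sphere G 2 p) + 2 = 2 * nb_int p +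
    \sum_(k < 6 | (p + dir k \in B)%R) nb_int (p + dir k)%R)%N.
  rewrite nb_edges_sphere2 // -[X in (_ + X)%N = _]e1
    [X in (_ = _ + X)%N]big_mkcond {1}/nb_int big_distrr -!big_split /=.
  apply: eq_bigr => k _; case: ifP => Bk.
    have Vk : V (p + dir k) by move: Bk; rewrite boundaryE => /andP[].
    have nIk : I (p + dir k) = false.
      by move: Bk; rewrite boundaryE => /andP[_ /negbTE].
    (* In the ring around [p + dir k], the point [p] sits at place [k + 3], so the last clause of
       the ring pattern applies. *)
    have [_ _ _ /(_ k (ltn_ord k)) ->] := boundary_ring Bk;
      last by rewrite -addrA dirD3 addr0.
    by rewrite Vk nIk mul1n muln0 add0n.
  rewrite !addn0; move: Bk; rewrite boundaryE; case Ik: (I (p + dir k)).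
    by rewrite interior_vert // !interior_dir.
  by rewrite andbT => ->.
have : (\sum_(k < 6 | (p + dir k \in B)%R) 1 = 2)%N.
  by rewrite big_mkcond -[RHS]e1; apply: eq_bigr => k _; case: ifP.
rewrite sumrB => e5 e6.
have -> : \sum_(k < 6 | p + dir k \in B) (2 : int) = 4.
  rewrite (eq_bigr (fun=> 2 * 1%N%:R)) => [|k _]; last by rewrite mulr1.
  by rewrite -mulr_sumr -natr_sum e5.
have -> : \sum_(k < 6 | p + dir k \in B) (nb_int (p + dir k))%:Z =
    (\sum_(k < 6 | (p + dir k \in B)%R) nb_int (p + dir k)%R)%N%:Z.
  by rewrite -natz natr_sum; apply: eq_bigr => k _; rewrite natz.
lia.
Qed.

(** * Summation over the domain *)

Lemma sum_neighbours (A : zmodType) (F : int * int -> A)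
    (L : seq (int * int)) p :
  uniq L ->
  \sum_(q <- L | edge X p q) F q = \sum_(k < 6 | p + dir k \in L) F (p + dir k).
Proof.
move=> uL; rewrite -[RHS](big_mkord (fun k => p + dir k \in L)
  (fun k => F (p + dir k))).
rewrite -(big_map dir (fun d => p + d \in L) (fun d => F (p + d))).
rewrite -(big_map (fun d => p + d) (mem L) F) -[RHS]big_filter -[LHS]big_filter.
apply/perm_big/uniq_perm; rewrite ?filter_uniq //.
  by rewrite map_inj_uniq //; exact: addrI.
move=> q; rewrite !mem_filter andbC; congr (_ && _).
apply/idP/mapP => [/lattice_dirP[k klt ->]|[d dd ->]].
  by exists (dir k) => //; apply: dir_mem.
by rewrite lattice_offset0.
Qed.

Hypothesis finG : finite_set (vert G).

Let L : seq (int * int) := fset_set (vert G).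

Lemma mem_vert_seq p : (p \in L) = V p.
Proof. by rewrite /L in_fset_set. Qed.

Lemma euler_boundary :
  6 * euler_char G = \sum_(p <- L | p \in B) (2 - (nb_int p)%:Z).
Proof.
have uL : uniq L by exact: fset_uniq.
have GL p : vert G p -> p \in L by rewrite mem_vert_seq /V inE.
have e : (2 * nb_edges G)%N%:Z =
  \sum_(p <- L) (\sum_(k < 6) V (p + dir k)%R)%N%:Z.
  rewrite (nb_edges_degree uL GL) -[LHS]natz natr_sum.
  rewrite big_seq_cond [RHS]big_seq_cond; apply: eq_bigr => p /andP[pL _].
  rewrite -sum1_count !natz -natz natr_sum.
  transitivity (\sum_(q <- L | edge X p q) (1 : int)).
    rewrite big_seq_cond [RHS]big_seq_cond; apply: eq_bigl => q.
    by case qL: (q \in L) => //=;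
      rewrite fG -/(V p) -/(V q) -!mem_vert_seq pL qL !andbT.
  rewrite sum_neighbours // -[RHS]natz natr_sum big_mkcond;
  apply: eq_bigr => k _.
  by rewrite mem_vert_seq; case: (V _).
have f : (3 * nb_faces G)%N%:Z = \sum_(p <- L) (nb_edges (sphere G 1 p))%:Z.
  by rewrite (nb_faces_link uL GL) -[LHS]natz natr_sum; apply: eq_bigr => p _;
    rewrite natz.
have v : (nb_vert G)%:Z = \sum_(p <- L) 1.
  by rewrite -[LHS]natz /nb_vert -sum1_size natr_sum.
(* The factor 6 exposes the twofold edge count and the threefold face count as sums over
   vertices. *)
have -> : 6 * euler_char G = 6 * (nb_vert G)%:Z - 3 * (2 * nb_edges G)%N%:Z
   + 2 * (3 * nb_faces G)%N%:Z by rewrite /euler_char; lia.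
rewrite v e f !mulr_sumr -sumrB -big_split /= [RHS]big_mkcond.
rewrite big_seq_cond [RHS]big_seq_cond; apply: eq_bigr => p /andP[pL _].
have Vp : V p by rewrite -mem_vert_seq.
case: ifP => Bp.
  (* With a = [nb_int p], the contribution is 6 - 3(a + 2) + 2(a + 1) = 2 - a. *)
  have [_ -> e3 _] := boundary_ring Bp.
  rewrite nb_edges_sphere1 // e3; lia.
(* At an interior point all six neighbours and all six link edges are present, giving 6 - 18 + 12 =
   0. *)
have Ip : I p by move: Bp; rewrite boundaryE Vp => /negbFE.
rewrite nb_edges_sphere1 //.
under eq_bigr do rewrite interior_dir //.
under [in X in _ + X]eq_bigr do rewrite !interior_dir //.
by rewrite !sum_nat_const card_ord.
Qed.

Lemma sum_curvature :
  \sum_(p <- L | p \in B) curvature G p =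
    \sum_(p <- L | p \in B) 2 * (2 - (nb_int p)%:Z).
Proof.
pose t p : int := 2 - (nb_int p)%:Z.
pose M := [seq p <- L | p \in B].
have uM : uniq M by rewrite filter_uniq // fset_uniq.
have mM p : (p \in M) = (p \in B).
  by rewrite mem_filter mem_vert_seq boundaryE; case: (V p);
    rewrite ?andbF ?andbT.
rewrite -big_filter -[RHS]big_filter -/M.
transitivity (\sum_(p <- M) \sum_(q <- M | edge X p q) t q).
  rewrite big_seq_cond [RHS]big_seq_cond; apply: eq_bigr => p;
    rewrite andbT mM => Bp.
  rewrite boundary_curvature // sum_neighbours //; apply: eq_bigl => k.
  by rewrite mM.
(* Adjacency is symmetric, so after the exchange each [t q] is counted once for each of the two
   boundary neighbours of [q]. *)
rewrite (exchange_big_dep xpredT) //=.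
rewrite big_seq_cond [RHS]big_seq_cond; apply: eq_bigr => q;
  rewrite andbT mM => Bq.
rewrite (eq_bigl (edge X q)); last by move=> p; rewrite edge_sym.
rewrite (@sum_neighbours _ (fun=> t q)) //.
have [e1 _ _ _] := boundary_ring Bq.
transitivity ((\sum_(k < 6) ((q + dir k)%R \in B))%N%:R * t q);
  last by rewrite e1.
rewrite natr_sum mulr_suml big_mkcond.
by apply: eq_bigr => k _; rewrite mM; case: ifP; rewrite ?mul1r ?mul0r.
Qed.

End Domain.
End Lattice.

Theorem theorem6 (R : realType) (G : graph (int * int)%type) :
  let X := triangular_lattice R in
  domain X G -> finite_set (vert G) -> smooth X G ->
  \sum_(p \in boundary X G) curvature G p = 12 * euler_char G.
Proof.
move=> X dG finG sG.
have BV : boundary X G `<=` vert G by move=> p [].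
have finB : finite_set (boundary X G) by exact: sub_finite_set BV finG.
rewrite fsbig_finite //=.
transitivity (\sum_(p <- fset_set (vert G) | p \in boundary X G) curvature G p).
  rewrite -[RHS]big_filter; apply/perm_big/uniq_perm.
  - exact: fset_uniq.
  - by rewrite filter_uniq // fset_uniq.
  move=> p; rewrite mem_filter !in_fset_set //.
  by apply/idP/andP => [|[]//]; rewrite !inE => Bp; split=> //; exact: BV.
rewrite sum_curvature // -mulr_sumr -euler_boundary //.
by rewrite mulrA.
Qed.
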